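(* Let $A$ be a ring. Let $B$ be an $A$-algebra. Let $x\in B$ and $y\in B$. Let $m\in\mathbb{N}$ and $n\in\mathbb{N}$. Let $u\in B$. Assume that $u$ is $n$-integral over $A[x]$, and that $u$ is $m$-integral over $A[y]$. Then there exists some $\lambda\in\mathbb{N}$ such that $u$ is $\lambda$-integral over $A[xy]$.
   Context: All rings are commutative with unity, and ''$A$-algebra'' means commutative unital $A$-algebra (the structure map $A\to B$ need not be injective). $\mathbb{N}=\{0,1,2,\ldots\}$. For an $A$-algebra $B$ and $v\in B$, $A[v]=\{P(v)\mid P\in A[X]\}$ is the $A$-subalgebra of $B$ generated by $v$; $B$ is an $A[v]$-algebra since $A[v]$ is a subring of $B$. For a ring $A$, an $A$-algebra $B$ and $n\in\mathbb{N}$, an element $u\in B$ is called $n$-integral over $A$ if there exists a monic polynomial $P\in A[X]$ with $\deg P=n$ (that is, $P=X^n+\sum_{k=0}^{n-1}a_kX^k$ with $a_k\in A$) and $P(u)=0$. *)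

(* Defs.v *)
From HB Require Import structures.
From mathcomp Require Import all_boot all_order all_algebra.
From mathcomp Require Import boolp.

Set Implicit Arguments.
Unset Strict Implicit.
Unset Printing Implicit Defensive.

Import GRing.Theory.
Local Open Scope ring_scope.

(* The zero ring is allowed, hence [comPzRingType].  MathComp's algebra
   structures and [{poly _}] exclude it, so an A-algebra B is given by its
   structure map f : {rmorphism A -> B}, and a polynomial of degree < n by the
   family of its n coefficients. *)

(* Value at v of the polynomial \sum_(k < n) a_k X^k, coefficients acting on B
   through f. *)
Definition poly_value (A B : comPzRingType) (f : {rmorphism A -> B})
    (n : nat) (a : 'I_n -> A) (v : B) : B :=
  \sum_(k < n) f (a k) * v ^+ k.

Definition n_integral (A B : comPzRingType) (f : {rmorphism A -> B})
    (n : nat) (u : B) : Prop :=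
  exists a : 'I_n -> A, u ^+ n + poly_value f a u = 0.

Definition adjoin_pred (A B : comPzRingType) (f : {rmorphism A -> B})
    (v : B) : {pred B} :=
  fun b => `[< exists (n : nat) (a : 'I_n -> A), b = poly_value f a v >].

Section AdjoinRing.

Variables (A B : comPzRingType) (f : {rmorphism A -> B}) (v : B).

Lemma adjoin_predP (b : B) :
  reflect (exists (n : nat) (a : 'I_n -> A), b = poly_value f a v)
          (b \in adjoin_pred f v).
Proof. exact: asboolP. Qed.

Lemma adjoin_pred_nat (n : nat) (a : nat -> A) :
  \sum_(k < n) f (a k) * v ^+ k \in adjoin_pred f v.
Proof. by apply/adjoin_predP; exists n, (fun k => a k). Qed.

Lemma adjoin_pred_natP (b : B) : b \in adjoin_pred f v ->
  exists (n : nat) (a : nat -> A),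
    (forall k, (n <= k)%N -> a k = 0) /\ b = \sum_(k < n) f (a k) * v ^+ k.
Proof.
move=> /adjoin_predP[n [a ->]].
exists n, (fun k => if insub k is Some i then a i else 0); split.
  by move=> k nk; rewrite insubF // ltnNge nk.
by apply: eq_bigr => i _; rewrite valK.
Qed.

Lemma adjoin_pred_widen (n m : nat) (a : nat -> A) :
  (forall k, (n <= k)%N -> a k = 0) -> (n <= m)%N ->
  \sum_(k < n) f (a k) * v ^+ k = \sum_(k < m) f (a k) * v ^+ k.
Proof.
move=> a0 nm; rewrite (big_ord_widen m (fun k => f (a k) * v ^+ k)) //.
rewrite big_mkcond /=; apply: eq_bigr => i _; case: ltnP => // ni.
by rewrite a0 // rmorph0 mul0r.
Qed.

Lemma adjoin_predD : {in adjoin_pred f v &, forall b c,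
  b + c \in adjoin_pred f v}.
Proof.
move=> b c /adjoin_pred_natP[n [a [a0 ->]]] /adjoin_pred_natP[m [d [d0 ->]]].
rewrite (adjoin_pred_widen a0 (leq_addr m n)).
rewrite (adjoin_pred_widen d0 (leq_addl n m)) -big_split /=.
under eq_bigr do rewrite -mulrDl -rmorphD.
exact: (adjoin_pred_nat (n + m) (fun k => a k + d k)).
Qed.

Lemma adjoin_pred_monomial (c : A) (k : nat) :
  f c * v ^+ k \in adjoin_pred f v.
Proof.
suff -> : f c * v ^+ k =
    \sum_(i < k.+1) f (if i == k :> nat then c else 0) * v ^+ i.
  exact: (adjoin_pred_nat k.+1 (fun i => if i == k then c else 0)).
rewrite big_ord_recr /= eqxx big1 ?add0r // => i _.
by rewrite (ltn_eqF (ltn_ord i)) rmorph0 mul0r.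
Qed.

Lemma adjoin_pred_sum (n : nat) (F : 'I_n -> B) :
  (forall i, F i \in adjoin_pred f v) -> \sum_i F i \in adjoin_pred f v.
Proof.
move=> FP; apply: (big_ind (fun b => b \in adjoin_pred f v)) => //; last exact: adjoin_predD.
by rewrite -(mul0r (v ^+ 0)) -(rmorph0 f); exact: adjoin_pred_monomial.
Qed.

Lemma adjoin_pred_subring : subring_closed (adjoin_pred f v).
Proof.
split.
- by rewrite -(mulr1 1) -{1}(rmorph1 f) -(expr0 v); exact: adjoin_pred_monomial.
- move=> b c bP /adjoin_predP[n [a ->]]; apply: adjoin_predD => //.
  rewrite -sumrN; apply: adjoin_pred_sum => i.
  by rewrite -mulNr -rmorphN; exact: adjoin_pred_monomial.
- move=> b c /adjoin_predP[n [a ->]] /adjoin_predP[m [d ->]].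
  rewrite mulr_suml; apply: adjoin_pred_sum => i.
  rewrite mulr_sumr; apply: adjoin_pred_sum => j.
  by rewrite mulrACA -rmorphM -exprD; exact: adjoin_pred_monomial.
Qed.

HB.instance Definition _ :=
  GRing.isSubringClosed.Build B (adjoin_pred f v) adjoin_pred_subring.

(* The subring A[v] of B. *)
Record adjoin := Adjoin { adjoin_val :> B; _ : adjoin_val \in adjoin_pred f v }.

HB.instance Definition _ := [isSub for adjoin_val].
HB.instance Definition _ := [Choice of adjoin by <:].
HB.instance Definition _ := GRing.SubChoice_isSubComPzRing.Build
  B (adjoin_pred f v) adjoin adjoin_pred_subring.

Lemma adjoin_val_nmod_morphism : nmod_morphism adjoin_val.
Proof. by split; [exact: (rmorph0 val) | exact: (rmorphD val)]. Qed.

Lemma adjoin_val_monoid_morphism : monoid_morphism adjoin_val.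
Proof. by split; [exact: (rmorph1 val) | exact: (rmorphM val)]. Qed.

(* The inclusion A[v] -> B, making B an A[v]-algebra. *)
HB.instance Definition _ :=
  GRing.isNmodMorphism.Build adjoin B adjoin_val adjoin_val_nmod_morphism.
HB.instance Definition _ :=
  GRing.isMonoidMorphism.Build adjoin B adjoin_val adjoin_val_monoid_morphism.

Definition adjoin_incl : {rmorphism adjoin -> B} := adjoin_val.

End AdjoinRing.

(* Main.v *)
Require Import Defs.
From HB Require Import structures.
From mathcomp Require Import all_boot all_order all_algebra.
From mathcomp Require Import boolp.

(** Write w = x y.  It suffices to find finitely many elements of B, one of
    them 1, whose A[w]-span M satisfies u M <= M: multiplication by u on these
    generators is then given by a square matrix C over A[w], and u is a root of
    the characteristic polynomial of C, which is monic
    ([n_integral_of_stable_span]).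

    Let P in A[x][X] and Q in A[y][X] be the given monic polynomials, of degrees
    n and m, with coefficients of degree < dx in x and < dy in y.  The module M
    is generated by the x^i u^k with i <= dx + dy and k <= n + m.  Only
    x^i u^(n+m+1) has to be brought back into M, and the choice of the relation
    depends on i.
    - If i < dy, replace u^n by its expression from P(u) = 0: the exponent of x
      stays below dy + dx.
    - If i >= dy, replace u^m by its expression from Q(u) = 0: the powers y^j
      which appear have j < dy <= i, and x^i y^j = w^j x^(i-j), so that y is
      absorbed in the scalars and the exponent of x does not increase.
    Thus the x-relation pushes the exponent of x up, the y-relation pulls it
    down, and no power of y is ever needed among the generators. *)

Set Implicit Arguments.
Unset Strict Implicit.
Unset Printing Implicit Defensive.

Import GRing.Theory.
Local Open Scope ring_scope.

(** The matrix u - C annihilates the column v; multiplying by its adjugate,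
    det (u - C) annihilates every entry of v, in particular v i0 = 1. *)
Lemma char_poly_root_of_stable_family (R B : comNzRingType)
    (g : {rmorphism R -> B}) (u : B) (N : nat) (v : 'I_N -> B) (C : 'M[R]_N)
    (i0 : 'I_N) :
  v i0 = 1 -> (forall i, u * v i = \sum_j g (C i j) * v j) ->
  (map_poly g (char_poly C)).[u] = 0.
Proof.
move=> v1 uv.
have cfu : commr_rmorph g u by move=> a; exact: mulrC.
pose D : 'M[B]_N := u%:M - map_mx g C.
have detD : \det D = (map_poly g (char_poly C)).[u].
  rewrite -[RHS]/(horner_morph cfu (char_poly C)) -det_map_mx; congr (\det _).
  apply/matrixP=> i j.
  by rewrite !mxE rmorphB rmorphMn /= horner_morphX horner_morphC.
pose V : 'cV[B]_N := \col_i v i.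
have DV : D *m V = 0.
  apply/matrixP=> i j; rewrite mulmxBl mul_scalar_mx !mxE uv.
  by under [X in _ - X]eq_bigr do rewrite !mxE; rewrite subrr.
have := congr1 (fun M : 'cV_N => M i0 0) (congr1 (mulmx (\adj D)) DV).
rewrite mulmxA mul_adj_mx mulmx0 mul_scalar_mx !mxE v1 mulr1 => <-.
by rewrite detD.
Qed.

Lemma n_integral_monic_root (R B : comNzRingType) (g : {rmorphism R -> B})
    (u : B) (p : {poly R}) :
  p \is monic -> (map_poly g p).[u] = 0 -> n_integral g (size p).-1 u.
Proof.
move=> pmon pu; exists (fun k => p`_k).
have sp : (size (map_poly g p) <= (size p).-1.+1)%N.
  by rewrite -polySpred ?monic_neq0 // size_poly.
rewrite -pu (horner_coef_wide _ sp) big_ord_recr /= [RHS]addrC; congr (_ + _).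
  by rewrite coef_map /= -lead_coefE (monicP pmon) rmorph1 mul1r.
by apply: eq_bigr => i _; rewrite coef_map.
Qed.

Lemma n_integral_of_stable_family (R B : comPzRingType)
    (g : {rmorphism R -> B}) (u : B) (N : nat) (v : 'I_N -> B) (C : 'M[R]_N)
    (i0 : 'I_N) :
  v i0 = 1 -> (forall i, u * v i = \sum_j g (C i j) * v j) ->
  n_integral g N u.
Proof.
move=> v1 uv; have [B0|B0] := eqVneq (1 : B) 0.
  by exists (fun=> 0); rewrite -[LHS]mul1r B0 mul0r.
have R0 : (1 : R) != 0.
  by apply: contraNneq B0 => R0; rewrite -(rmorph1 g) R0 rmorph0.
(* B being nontrivial, so is R, and both can be given the structure of a
   nontrivial ring, over which characteristic polynomials are available. *)
pose R' : comNzRingType :=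
  HB.pack (R : Type) R (GRing.PzSemiRing_isNonZero.Build R R0).
pose B' : comNzRingType :=
  HB.pack (B : Type) B (GRing.PzSemiRing_isNonZero.Build B B0).
pose g' : {rmorphism R' -> B'} := g.
have root_u := @char_poly_root_of_stable_family R' B' g' u N v C i0 v1 uv.
have := n_integral_monic_root (char_poly_monic (C : 'M[R']_N)) root_u.
by rewrite size_char_poly.
Qed.

Section Span.

Variables (R B : comPzRingType) (g : {rmorphism R -> B}).
Variables (T : finType) (v : T -> B).

Definition in_span (z : B) : Prop :=
  exists c : T -> R, z = \sum_t g (c t) * v t.

Lemma in_span0 : in_span 0.
Proof. by exists (fun=> 0); rewrite big1 // => t _; rewrite rmorph0 mul0r. Qed.

Lemma in_spanD z z' : in_span z -> in_span z' -> in_span (z + z').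
Proof.
move=> [c ->] [c' ->]; exists (fun t => c t + c' t).
by rewrite -big_split; apply: eq_bigr => t _; rewrite rmorphD mulrDl.
Qed.

Lemma in_spanZ r z : in_span z -> in_span (g r * z).
Proof.
move=> [c ->]; exists (fun t => r * c t); rewrite mulr_sumr.
by apply: eq_bigr => t _; rewrite rmorphM mulrA.
Qed.

Lemma in_spanN z : in_span z -> in_span (- z).
Proof. by move=> Sz; rewrite -mulN1r -(rmorph1 g) -rmorphN; apply: in_spanZ. Qed.

Lemma in_span_sum (I : finType) (F : I -> B) :
  (forall i, in_span (F i)) -> in_span (\sum_i F i).
Proof.
by move=> SF; apply: (big_ind in_span) => //; [exact: in_span0|exact: in_spanD].
Qed.

Lemma in_span_gen t : in_span (v t).
Proof.
exists (fun t' => (t' == t)%:R); rewrite (bigD1 t) //= eqxx rmorph1 mul1r.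
by rewrite big1 ?addr0 // => i /negPf ->; rewrite rmorph0 mul0r.
Qed.

(** Coordinates of the u * v t form the matrix to which the determinant trick
    applies. *)
Lemma n_integral_of_stable_span (u : B) (t0 : T) :
  v t0 = 1 -> (forall t, in_span (u * v t)) -> n_integral g #|T| u.
Proof.
move=> v1 /choice[c uv].
apply: (@n_integral_of_stable_family _ _ g u #|T| (fun i => v (enum_val i))
  (\matrix_(i, j) c (enum_val i) (enum_val j)) (enum_rank t0)).
  by rewrite enum_rankK.
move=> i; rewrite uv (reindex (@enum_val T T)) /=.
  by apply: eq_bigr => j _; rewrite mxE.
exact/onW_bij/enum_val_bij.
Qed.

End Span.

(** A rewriting rule for u ^+ n that only mentions A.  The bound d is common to
    the coefficients of all the powers of u, because the range of exponents of
    the spanning family is chosen from it. *)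
Lemma n_integral_adjoinE (A B : comPzRingType) (f : {rmorphism A -> B})
    (v : B) (n : nat) (u : B) :
  n_integral (adjoin_incl f v) n u ->
  exists (d : nat) (c : 'I_n -> nat -> A),
    u ^+ n = - \sum_(k < n) \sum_(i < d) f (c k i) * v ^+ i * u ^+ k.
Proof.
move=> [a /eqP]; rewrite addr_eq0 => /eqP ua.
have /choice[dc dcP] (k : 'I_n) : exists dc : nat * (nat -> A),
    (forall i, (dc.1 <= i)%N -> dc.2 i = 0) /\
    adjoin_val (a k) = \sum_(i < dc.1) f (dc.2 i) * v ^+ i.
  by have [d [c cP]] := adjoin_pred_natP (valP (a k)); exists (d, c).
exists (\max_(k < n) (dc k).1), (fun k => (dc k).2).
rewrite ua /poly_value; congr (- _); apply: eq_bigr => k _.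
have [c0 ak] := dcP k; rewrite [adjoin_incl f v _]ak -mulr_suml.
by rewrite -(adjoin_pred_widen f v c0 (leq_bigmax k)).
Qed.

Theorem theorem5p5 (A B : comPzRingType) (f : {rmorphism A -> B}) (x y : B)
    (m n : nat) (u : B)
    (hx : n_integral (adjoin_incl f x) n u)
    (hy : n_integral (adjoin_incl f y) m u) :
  exists l : nat, n_integral (adjoin_incl f (x * y)) l u.
Proof.
have [dx [cx ux]] := n_integral_adjoinE hx.
have [dy [cy uy]] := n_integral_adjoinE hy.
pose g := adjoin_incl f (x * y).
(* The successors make 1 = x^0 u^0 a generator even when m, n, dx and dy all
   vanish. *)
pose T := ('I_(dx + dy).+1 * 'I_(n + m).+1)%type.
pose v (t : T) : B := x ^+ t.1 * u ^+ t.2.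
have scale (a : A) (j : nat) (z : B) :
    in_span g v z -> in_span g v (f a * (x * y) ^+ j * z).
  pose r : adjoin f (x * y) := Adjoin (adjoin_pred_monomial f (x * y) a j).
  exact: (@in_spanZ _ _ g _ v r).
have gen (i k : nat) : (i < (dx + dy).+1)%N -> (k < (n + m).+1)%N ->
    in_span g v (x ^+ i * u ^+ k).
  by move=> iD kK; exact: (in_span_gen g v (Ordinal iD, Ordinal kK)).
exists #|{: T}|.
apply: (@n_integral_of_stable_span _ _ g _ v u (ord0, ord0)).
  by rewrite /v !expr0 mulr1.
move=> [i k]; rewrite /v /= mulrCA -exprS.
have [kK|Kk] := ltnP k (n + m); first exact: gen.
have {Kk} -> : k = (n + m)%N :> nat.
  by apply/eqP; rewrite eqn_leq Kk -ltnS ltn_ord.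
(* The threshold dy is what x^i y^j = (x y)^j x^(i - j), for j < dy, requires;
   below it the x-relation still has dx exponents to spare. *)
have [i_small|i_large] := ltnP i dy.
  have -> : u ^+ (n + m).+1 = u ^+ n * u ^+ m.+1 by rewrite -exprD addnS.
  rewrite ux mulNr mulrN mulr_suml mulr_sumr.
  apply/in_spanN/in_span_sum => k'.
  rewrite mulr_suml mulr_sumr; apply: in_span_sum => i'.
  have -> : x ^+ i * (f (cx k' i') * x ^+ i' * u ^+ k' * u ^+ m.+1) =
      f (cx k' i') * (x * y) ^+ 0 * (x ^+ (i + i') * u ^+ (k' + m.+1)).
    by rewrite expr0 mulr1 !exprD -!mulrA mulrCA.
  apply/scale/gen; first by rewrite ltnS addnC leq_add // ltnW.
  by rewrite -(addnS n) ltn_add2r.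
have -> : u ^+ (n + m).+1 = u ^+ m * u ^+ n.+1.
  by rewrite -exprD addnS [(m + n)%N]addnC.
rewrite uy mulNr mulrN mulr_suml mulr_sumr.
apply/in_spanN/in_span_sum => k'.
rewrite mulr_suml mulr_sumr; apply: in_span_sum => j.
have le_ji : (j <= i)%N by exact: leq_trans (ltnW (ltn_ord j)) i_large.
have -> : x ^+ i * (f (cy k' j) * y ^+ j * u ^+ k' * u ^+ n.+1) =
    f (cy k' j) * (x * y) ^+ j * (x ^+ (i - j) * u ^+ (k' + n.+1)).
  rewrite -{1}(subnK le_ji) !exprD exprMn.
  rewrite -!mulrA (mulrCA (y ^+ j) (x ^+ (i - j))).
  rewrite (mulrCA (x ^+ j) (x ^+ (i - j))) (mulrCA (x ^+ j) (f _)).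
  exact: mulrCA.
apply/scale/gen; first exact: leq_ltn_trans (leq_subr _ _) (ltn_ord i).
by rewrite [(n + m)%N]addnC -(addnS m) ltn_add2r.
Qed.
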